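(* Let $G$ be a paratopological group. If $G$ contains a subspace homeomorphic to a stationary subset of some uncountable regular cardinal, then: (1) $G$ is not hereditarily normal or $G$ is not hereditarily collectionwise Hausdorff; (2) $G$ is not hereditarily collectionwise normal.
   Context: All spaces are Tychonoff. A paratopological group is a group endowed with a topology for which the group multiplication $G\times G\to G$ is (jointly) continuous. Subsets of ordinals carry the subspace topology of the order topology. A subset of a regular uncountable cardinal $\kappa$ is stationary if it meets every closed unbounded subset of $\kappa$. A space is hereditarily $P$ if every subspace has property $P$. *)

(* Defs.v *)
From mathcomp Require Import all_boot all_order all_algebra.
From mathcomp Require Import all_classical all_reals all_analysis.
Set Implicit Arguments. Unset Strict Implicit. Unset Printing Implicit Defensive.
Local Open Scope classical_set_scope.

Section Rel.
Variable T : topologicalType.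

Definition rel_open (A U : set T) := exists V, open V /\ U = A `&` V.
Definition rel_closed (A C : set T) := exists F, closed F /\ C = A `&` F.

Definition normal_on (A : set T) :=
  forall C D, rel_closed A C -> rel_closed A D -> C `&` D = set0 ->
  exists U V, [/\ rel_open A U, rel_open A V, C `<=` U, D `<=` V & U `&` V = set0].

Definition rel_closed_discrete (A D : set T) :=
  rel_closed A D /\
  forall x, D x -> exists U, rel_open A U /\ U `&` D = [set x].

Definition cwH_on (A : set T) :=
  forall D, rel_closed_discrete A D ->
  exists U : T -> set T,
    (forall d, D d -> rel_open A (U d) /\ U d d) /\
    (forall d d', D d -> D d' -> d <> d' -> U d `&` U d' = set0).

Definition rel_discrete_family (A : set T) (Fam : set (set T)) :=
  forall x, A x -> exists U, [/\ rel_open A U, U x &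
    forall F1 F2, Fam F1 -> Fam F2 -> U `&` F1 !=set0 -> U `&` F2 !=set0 -> F1 = F2].

Definition cwN_on (A : set T) :=
  forall Fam : set (set T),
  (forall F, Fam F -> rel_closed A F) -> rel_discrete_family A Fam ->
  exists U : set T -> set T,
    (forall F, Fam F -> rel_open A (U F) /\ F `<=` U F) /\
    (forall F1 F2, Fam F1 -> Fam F2 -> F1 <> F2 -> U F1 `&` U F2 = set0).

Definition hereditarily_normal := forall A : set T, normal_on A.
Definition hereditarily_cwH := forall A : set T, cwH_on A.
Definition hereditarily_cwN := forall A : set T, cwN_on A.

Definition tychonoff_space := completely_regular_space T /\ hausdorff_space T.
End Rel.

Definition paratopological_group (G : topologicalType)
  (mul : G -> G -> G) (e : G) (inv : G -> G) :=
  (forall x y z, mul x (mul y z) = mul (mul x y) z) /\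
  (forall x, mul e x = x) /\ (forall x, mul x e = x) /\
  (forall x, mul (inv x) x = e) /\ (forall x, mul x (inv x) = e) /\
  continuous (fun p : G * G => mul p.1 p.2).

Section Ord.
Variables (K : Type) (lt : K -> K -> Prop).

Definition strict_well_order :=
  [/\ (forall x, ~ lt x x), (forall x y z, lt x y -> lt y z -> lt x z),
      (forall x y, lt x y \/ x = y \/ lt y x) & well_founded lt].

Definition unbounded (C : set K) := forall x, exists y, C y /\ lt x y.

(* (K, lt) is (the well-order of ordinals below) an uncountable regular
   cardinal: an initial ordinal, uncountable, of cofinality itself. *)
Definition uncountable_regular_cardinal :=
  [/\ strict_well_order,
      (forall x, ~ (@setT K #<= [set y | lt y x])%card),
      ~ countable (@setT K) &
      (forall C : set K, unbounded C -> (@setT K #<= C)%card)].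

Definition in_iv (a b : option K) (y : K) :=
  (match a with Some a => lt a y | None => True end) /\
  (match b with Some b => lt y b | None => True end).

Definition ord_open (U : set K) :=
  forall x, U x -> exists a b, in_iv a b x /\ in_iv a b `<=` U.

Definition ord_closed (C : set K) := ord_open (~` C).

Definition club (C : set K) := ord_closed C /\ unbounded C.

Definition stationary (S : set K) := forall C, club C -> S `&` C !=set0.
End Ord.

Definition embeds_on (K : Type) (lt : K -> K -> Prop) (G : topologicalType)
  (S : set K) (f : K -> G) :=
  {in S &, injective f} /\
  forall U : set K,
    (exists V, ord_open lt V /\ U = S `&` V) <->
    (exists W : set G, open W /\ U = S `&` f @^-1` W).

(* Main.v *)
(** Let f embed a stationary set S into G, let p in S be a limit of S and J the set
   of isolated points of S. Assuming hereditary normality and hereditary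
   collectionwise Hausdorffness, the points f(j), j in J, have open neighbourhoods
   O(j) forming a family that is discrete off the set of accumulation points of f(J).
   For x in S below p and close to p, f(x) f(p)^-1 f(j) lies in O(j); as p is smaller
   than the cardinal, a single x < p works for unboundedly many j. With
   g = f(x) f(p)^-1 <> e, the map q = g f is another embedding of S, nowhere equal
   to f, and this forces q(y) to lie outside the closure of f(J) for some y in S that
   is a limit of those j. But q(j) in O(j) tends to q(y), where the family O is
   discrete, a contradiction. Collectionwise normality implies both properties. *)
Require Import Defs.
From mathcomp Require Import all_boot all_order all_algebra.
From mathcomp Require Import all_classical all_reals all_analysis.
Set Implicit Arguments.
Unset Strict Implicit.
Local Open Scope classical_set_scope.

(** Hilbert's hotel: [psi] moves each term of an injective sequence [chi] starting at [c] to the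
    next one and fixes all other points, so it is injective and misses [c]. *)
Lemma card_le_setC1 (T : Type) (c : T) :
  infinite_set [set: T] -> ([set: T] #<= ~` [set c])%card.
Proof.
move=> /infiniteP /card_leP[phi0].
pose phi n : T := val (phi0 (exist _ n (mem_set I))).
have phiI : injective phi.
  move=> m n /val_inj /(inj (mem_set I) (mem_set I)).
  by move=> /(congr1 val).
(* If [phi] reaches [c], start it there; otherwise put [c] in front. *)
have [chi chiI chi0] : exists2 chi : nat -> T, injective chi & chi 0%N = c.
  have [[m <-]|cN] := pselect (exists m, phi m = c).
    exists (fun n => phi (m + n)%N); last by rewrite addn0.
    by move=> n n' /phiI /addnI.
  exists (fun n => if n is n'.+1 then phi n' else c) => //.
  move=> [|n] [|n'] //=.
  - by move=> E; case: cN; exists n'.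
  - by move=> E; case: cN; exists n.
  - by move=> /phiI ->.
have /choice[psi psiP] : forall k, exists k',
    (exists2 n, k = chi n & k' = chi n.+1) \/ ((forall n, k <> chi n) /\ k' = k).
  move=> k; have [[n kn]|kN] := pselect (exists n, k = chi n).
    by exists (chi n.+1); left; exists n.
  by exists k; right; split => // n kn; apply: kN; exists n.
have psiI : {in setT &, injective psi}.
  move=> k k' _ _.
  have [[n kE ->]|[kN ->]] := psiP k; have [[n' kE' ->]|[kN' ->]] := psiP k' => // E.
  - by move: E => /chiI [nn']; rewrite kE kE' nn'.
  - by case: (kN' n.+1).
  - by case: (kN n'.+1).
rewrite -(card_le_eql (inj_card_eq psiI)); apply: subset_card_le.
move=> _ [k _ <-] /=; have [[n _ ->]|[kN ->]] := psiP k.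
  by rewrite -chi0 => /chiI.
by rewrite -chi0; apply: kN.
Qed.

(** * Strict well-orders *)

Section WellOrder.
Variables (K : Type) (lt : K -> K -> Prop).
Hypothesis wo : strict_well_order lt.

Lemma ordlt_irr x : ~ lt x x.
Proof. by case: wo. Qed.

Lemma ordlt_trans x y z : lt x y -> lt y z -> lt x z.
Proof. by case: wo => _ + _ _; apply. Qed.

Lemma ordnlt x y : ~ lt x y -> y = x \/ lt y x.
Proof. by case: wo => _ _ /(_ x y)[|[->|]] //; [left|right]. Qed.

Lemma ordle_lt_trans x y z : ~ lt y x -> lt y z -> lt x z.
Proof. by move=> /ordnlt[->//|]; apply: ordlt_trans. Qed.

Lemma ordlt_le_trans x y z : lt x y -> ~ lt z y -> lt x z.
Proof. by move=> xy /ordnlt[<-//|]; apply: ordlt_trans. Qed.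

Lemma well_order_min (A : set K) : A !=set0 ->
  exists2 x, A x & forall y, A y -> ~ lt y x.
Proof.
move=> [x0 Ax0]; apply: contrapT => noMin.
have AN : forall x, ~ A x.
  case: wo => _ _ _ wf; apply: (well_founded_ind wf) => x IH Ax.
  by apply: noMin; exists x => // y Ay /IH.
exact: AN Ax0.
Qed.

Lemma ordlt_max x y z : lt x z -> lt y z ->
  exists m, [/\ lt m z, ~ lt m x & ~ lt m y].
Proof.
move=> xz yz; have [xy|/ordnlt[->|yx]] := pselect (lt x y).
- by exists y; split => //; [move=> /ordlt_trans /(_ xy)|]; exact: ordlt_irr.
- by exists x; split => //; exact: ordlt_irr.
- by exists x; split => //; [|move=> /ordlt_trans /(_ yx)]; exact: ordlt_irr.
Qed.

End WellOrder.

(** The first clause excludes the least element of [K], for which the second is vacuous. *)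
Definition limit_of (K : Type) (lt : K -> K -> Prop) (X : set K) y :=
  (exists s, lt s y) /\
  forall s, lt s y -> exists t, [/\ X t, lt s t & lt t y].

(** The half-open interval $(s,y]$ meets [X] only in [y]; the least element of [K], having no such
    [s], is left out. *)
Definition isolated_in (K : Type) (lt : K -> K -> Prop) (X : set K) y :=
  X y /\ exists2 s, lt s y & forall t, X t -> lt s t -> ~ lt t y.

(** * Bounds, stationary sets and pressing down in a regular cardinal *)

Section RegularCardinal.
Variables (K : Type) (lt : K -> K -> Prop).
Hypothesis regK : uncountable_regular_cardinal lt.

Let wo : strict_well_order lt. Proof. by case: regK. Qed.

(** The segment below a maximum [m] would be [K] without [m], hence as large as [K], although [K] is
    an initial ordinal. *)
Lemma unboundedT : unbounded lt [set: K].
Proof.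
move=> m; apply: contrapT => m_max.
case: regK => _ small uncK _.
have infK : infinite_set [set: K] by move=> /finite_set_countable.
apply: (small m); apply: card_le_trans (card_le_setC1 m infK) _; apply: subset_card_le => y /= ym.
have /(ordnlt wo)[my|//] : ~ lt m y by move=> my; apply: m_max; exists y.
by case: ym; rewrite my.
Qed.

Lemma small_bounded (C : set K) : ~ ([set: K] #<= C)%card ->
  exists x, forall y, C y -> lt y x.
Proof.
move=> smallC; have [x xC] : exists x, forall y, C y -> ~ lt x y.
  apply: contrapT => CN; apply: smallC; case: regK => _ _ _; apply => x.
  apply: contrapT => xN; apply: CN; exists x => y Cy xy.
  by apply: xN; exists y.
have [z [_ xz]] := unboundedT x.
by exists z => y /xC xy; apply: (ordle_lt_trans wo xy).
Qed.

Lemma countable_bounded (u : nat -> K) : exists x, forall n, lt (u n) x.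
Proof.
have [|x xP] := @small_bounded (range u); last by exists x => n; apply: xP; exists n.
case: regK => _ _ uncK _ leKu; apply: uncK; apply: card_le_trans leKu _.
exact: card_image_le.
Qed.

Lemma lt_above2 x y : exists z, lt x z /\ lt y z.
Proof.
have [u uP] := countable_bounded (fun n => if n is 0%N then x else y).
by exists u; split; [exact: (uP 0%N)|exact: (uP 1%N)].
Qed.

Lemma segment_bounded (b : K -> K) p : exists x, forall r, lt r p -> lt (b r) x.
Proof.
have [|x xP] := @small_bounded (b @` [set r | lt r p]).
  case: regK => _ /(_ p) smallp _ _ leKp; apply: smallp.
  exact: card_le_trans leKp (card_image_le _ _).
by exists x => r rp; apply: xP; exists r.
Qed.

Lemma succ_ex x : exists s, forall y, lt y s <-> ~ lt x y.
Proof.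
have [y [_ xy]] := unboundedT x.
have [|s xs s_min] := @well_order_min K lt wo [set y | lt x y]; first by exists y.
exists s => z; split => [zs /s_min//|xz].
exact: (ordle_lt_trans wo xz).
Qed.

(** The points above [z] closed under [b] form a club. This replaces explicit clubs in all later
    closing-off arguments. *)
Lemma stationary_closure_point (S : set K) (b : K -> K) z : stationary lt S ->
  exists y, [/\ S y, lt z y & forall r, lt r y -> lt (b r) y].
Proof.
pose C := [set y | lt z y /\ forall r, lt r y -> lt (b r) y].
suff clubC : club lt C by move=> /(_ _ clubC) [y [Sy [zy yb]]]; exists y.
split.
  move=> y /= /not_andP[zy|/existsNP[r /not_implyP[ry yb]]].
  - have [s sP] := succ_ex y.
    exists None, (Some s); split=> [|x [_ /= /sP yx] [zx _]].
      by split=> //=; apply/sP; exact: (ordlt_irr wo).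
    by apply: zy; apply: (ordlt_le_trans wo zx).
  - have [s sP] := succ_ex y.
    exists (Some r), (Some s); split=> [|x [/= rx /sP yx] [_ /(_ _ rx) bx]].
      by split=> //=; apply/sP; exact: (ordlt_irr wo).
    by apply: yb; apply: (ordlt_le_trans wo bx).
move=> x0.
have /choice[B BP] : forall x, exists y, lt x y /\ forall r, ~ lt x r -> lt (b r) y.
  move=> x; have [s sP] := succ_ex x; have [y yP] := segment_bounded b s.
  have [v [xv yv]] := lt_above2 x y.
  by exists v; split=> // r /sP /yP ry; exact: (ordlt_trans wo ry yv).
have [m [zm x0m]] := lt_above2 z x0.
pose u n := iter n B m.
(* With [y] the least strict bound of the iterates, any $r<y$ has $r\le u_n$ for some $n$, so
   $b(r)<u_{n+1}<y$. *)
have [|y yu y_min] := @well_order_min K lt wo [set y | forall n, lt (u n) y].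
  exact: countable_bounded.
exists y; split; last exact: (ordlt_trans wo x0m (yu 0%N)).
split; first exact: (ordlt_trans wo zm (yu 0%N)).
move=> r ry; apply: contrapT => byr; apply: (y_min r) ry => n.
apply: contrapT => rn; apply: byr.
exact: (ordlt_trans wo ((BP (u n)).2 _ rn) (yu n.+1)).
Qed.

Lemma stationary_unbounded (S : set K) : stationary lt S -> unbounded lt S.
Proof.
by move=> statS z; have [y [Sy zy _]] := stationary_closure_point id z statS; exists y.
Qed.

Lemma stationary_limit (S : set K) : stationary lt S ->
  exists2 y, S y & limit_of lt S y.
Proof.
move=> statS; have /choice[b bP] := stationary_unbounded statS.
have [z _] : [set: K] !=set0.
  apply/set0P/eqP => K0; case: regK => _ _ + _; apply.
  by rewrite K0; exact: countable0.
have [y [Sy zy yb]] := stationary_closure_point b z statS.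
exists y => //; split; first by exists z.
by move=> s sy; exists (b s); have [? ?] := bP s; split=> //; exact: yb.
Qed.

(** If all fibers over points below [p] were bounded, these bounds, fewer than [K] many, would have
    a common bound, and [X] could not go past it. *)
Lemma unbounded_fiber (X : set K) (phi : K -> K) p : unbounded lt X ->
  (forall x, X x -> lt (phi x) p) ->
  exists2 r, lt r p & unbounded lt [set x | X x /\ phi x = r].
Proof.
move=> ubX phip; apply: contrapT => rN.
have /choice[b bP] : forall r, exists c, lt r p ->
    forall x, X x -> phi x = r -> ~ lt c x.
  move=> r; have [rp|] := pselect (lt r p); last by exists r.
  apply: contrapT => cN; apply: rN; exists r => // c.
  apply: contrapT => xN; apply: cN; exists c => _ x Xx xr cx.
  by apply: xN; exists x.
have [c cP] := segment_bounded b p.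
have [x [Xx cx]] := ubX c; have xp := phip x Xx.
exact: (bP _ xp x Xx erefl (ordlt_trans wo (cP _ xp) cx)).
Qed.

(** The least element of [X] above [z] is isolated in [X], as witnessed by [z]. *)
Lemma unbounded_isolated (X : set K) :
  unbounded lt X -> unbounded lt (isolated_in lt X).
Proof.
move=> ubX z; have [|x [Xx zx] x_min] := @well_order_min K lt wo [set x | X x /\ lt z x].
  by have [x] := ubX z; exists x.
by exists x; split=> //; split=> //; exists z => // t Xt zt; exact: x_min.
Qed.

(** * Order neighbourhoods seen through an embedding *)

Section Embedding.
Variables (G : topologicalType) (S : set K) (f : K -> G).
Hypothesis embf : embeds_on lt S f.

Lemma embeds_inj x y : S x -> S y -> f x = f y -> x = y.
Proof. by case: embf => + _ Sx Sy; apply; exact/mem_set. Qed.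

(** The point [z] is the default for [s] when the basic interval around [y] has no lower end. *)
Lemma embeds_nbhs_below (W : set G) y z : open W -> S y -> W (f y) -> lt z y ->
  exists2 s, lt s y & forall t, S t -> lt s t -> ~ lt y t -> W (f t).
Proof.
move=> oW Sy Wy zy.
have [V [oV VE]] : exists V, ord_open lt V /\ S `&` f @^-1` W = S `&` V.
  by apply/embf.2; exists W.
have [_ /oV [a [b [[ay yb] abV]]]] : (S `&` V) y by rewrite -VE.
exists (if a is Some a then a else z); first by case: a ay {abV}.
move=> t St at_ yt; suff [] : (S `&` f @^-1` W) t by [].
rewrite VE; split=> //; apply: abV; split; first by case: a at_ {ay}.
by case: b yb => //= b yb; exact: (ordle_lt_trans wo yt).
Qed.

(** With [u] the successor of [y], the interval $(s,y]$ equals $(s,u)$ and is therefore open. *)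
Lemma embeds_interval s y :
  exists2 W, open W & forall t, S t -> (W (f t) <-> lt s t /\ ~ lt y t).
Proof.
have [u uP] := succ_ex y.
have [+ _] := embf.2 (S `&` in_iv lt (Some s) (Some u)).
case=> [|W [oW WE]].
  exists (in_iv lt (Some s) (Some u)); split=> // x xI.
  by exists (Some s), (Some u); split.
exists W => // t St; rewrite -uP; split=> [Wt|[st tu]].
  by have [] : (S `&` in_iv lt (Some s) (Some u)) t by rewrite WE.
by have [] : (S `&` f @^-1` W) t by rewrite -WE.
Qed.

Lemma embeds_isolated (X : set K) y : X `<=` S -> isolated_in lt X y ->
  exists W, [/\ open W, W (f y) & forall t, X t -> W (f t) -> t = y].
Proof.
move=> XS [Xy [s sy sX]]; have [W oW WP] := embeds_interval s y.
exists W; split=> // [|t Xt].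
  by apply/WP; [exact: XS|split=> //; exact: (ordlt_irr wo)].
move=> /(WP t (XS _ Xt)) [st yt].
by have [//|ty] := ordnlt wo yt; case: (sX t).
Qed.

End Embedding.

End RegularCardinal.

(** * Separation and closure in Hausdorff spaces *)

Lemma hausdorff_open (G : topologicalType) (x y : G) : hausdorff_space G -> x <> y ->
  exists U V, [/\ open U, open V, U x, V y & U `&` V = set0].
Proof.
rewrite open_hausdorff => hG /eqP /hG[[U V] /= [/set_mem Ux /set_mem Vy] [oU oV /eqP UV]].
by exists U, V.
Qed.

Lemma hausdorff_closed1 (G : topologicalType) (x : G) :
  hausdorff_space G -> closed [set x].
Proof. by move=> /hausdorff_accessible /accessible_closed_set1. Qed.

Lemma closure_meets (G : topologicalType) (A W : set G) z :
  closure A z -> open W -> W z -> exists2 y, A y & W y.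
Proof.
by move=> clA oW Wz; have [y [Ay Wy]] := clA W (open_nbhs_nbhs (conj oW Wz)); exists y.
Qed.

Lemma not_closure_open (G : topologicalType) (A : set G) z :
  ~ closure A z -> exists W, [/\ open W, W z & forall y, A y -> ~ W y].
Proof.
move=> zA; exists (~` closure A); split=> //.
  exact/closed_openC/closed_closure.
by move=> y Ay; apply; exact: subset_closure.
Qed.

Definition relatively_discrete (G : topologicalType) (D : set G) :=
  forall d, D d -> exists W, [/\ open W, W d & forall d', D d' -> W d' -> d' = d].

(** * Open expansions of relatively discrete sets *)

Section DiscreteExpansion.
Variables (G : topologicalType) (D : set G).
Hypotheses (hG : hausdorff_space G) (discD : relatively_discrete D).

Let A := ~` (closure D `\` D).

(** A neighbourhood isolating a point of [D] contains no other point of [closure D], since points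
    are closed. Thus [D] is closed in the open set [A], and sets open in [A] are open in [G]. *)
Lemma relatively_discrete_open_hull : open A.
Proof.
rewrite openE => z /= Az; rewrite /interior nbhsE /=.
have [Dz|zD] := pselect (D z); last first.
  exists (~` closure D); last by move=> y /= yD [].
  split; first exact/closed_openC/closed_closure.
  by move=> cz; apply: Az.
have [W [oW Wz WD]] := discD Dz; exists W => // y Wy [cy yD]; apply: yD.
suff -> : y = z by [].
apply: contrapT => yz.
have [| |d Dd [Wd dz]] := @closure_meets _ D (W `&` ~` [set z]) y cy.
  by apply: openI => //; exact/closed_openC/hausdorff_closed1.
  by split.
by apply: dz; exact: WD.
Qed.

Let D_A : D `<=` A. Proof. by move=> d Dd []. Qed.

Let D_closed : rel_closed A D.
Proof.
exists (closure D); split; first exact: closed_closure.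
apply/seteqP; split=> [d Dd|d [Ad cd]]; first by split; [exact: D_A|exact: subset_closure].
by apply: contrapT => dD; apply: Ad.
Qed.

Lemma cwH_disjoint_expansion : hereditarily_cwH G ->
  exists U : G -> set G, (forall d, D d -> open (U d) /\ U d d) /\
    forall d d' z, D d -> D d' -> U d z -> U d' z -> d = d'.
Proof.
move=> cwH; have [|U [UD Udisj]] := cwH A D.
  split=> // d Dd; have [W [oW Wd WD]] := discD Dd.
  exists (A `&` W); split; first by exists W.
  apply/seteqP; split=> [y [[_ Wy] Dy]|_ ->]; first exact: WD.
  by split=> //; split=> //; exact: D_A.
exists U; split=> [d /UD[[V [oV ->]] Ud]|d d' z Dd Dd' Uz Uz'].
  by split=> //; apply: openI => //; exact: relatively_discrete_open_hull.
apply: contrapT => dd'; suff : set0 z by [].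
by rewrite -(Udisj d d').
Qed.

(** Normality of [A] separates [D] from the part of [A] outside the union [B] of the disjoint sets
    [U d]; cutting each [U d] down to the neighbourhood [P] of [D] gives [O]. *)
Lemma discrete_open_expansion : hereditarily_cwH G -> hereditarily_normal G ->
  exists O : G -> set G, (forall d, D d -> open (O d) /\ O d d) /\
    forall z, (closure D z -> D z) -> exists N, [/\ open N, N z &
      forall d d' y y', D d -> D d' -> N y -> O d y -> N y' -> O d' y' -> d = d'].
Proof.
move=> /cwH_disjoint_expansion[U [UD Udisj]] nG.
pose B := \bigcup_(d in D) U d.
have oB : open B by apply: bigcup_open => d /UD[].
have [| |P [Q [[P' [oP PE]] [Q' [oQ QE]] DP BQ PQ]]] := nG A D (A `\` B) D_closed.
- by exists (~` B); split=> //; exact: open_closedC.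
- by apply/seteqP; split=> // d [Dd [_]]; apply; exists d => //; have [] := UD d Dd.
have oA := relatively_discrete_open_hull.
have {PE}oP : open P by rewrite PE; exact: openI.
have {QE}oQ : open Q by rewrite QE; exact: openI.
exists (fun d => U d `&` P); split=> [d Dd|z zD].
  have [oU Ud] := UD d Dd; split; first exact: openI.
  by split=> //; exact: DP.
(* A point of [B] has the neighbourhood [U d], which meets only one member; any other point of [A]
   lies in [Q], which misses [P] and so every member. *)
have [[d Dd Uz]|zB] := pselect (B z).
  exists (U d); split=> //; first by have [] := UD d Dd.
  move=> d1 d2 y1 y2 D1 D2 Uy1 [U1 _] Uy2 [U2 _].
  by rewrite -(Udisj d d1 y1)// -(Udisj d d2 y2).
exists Q; split=> // [|d1 d2 y1 _ _ _ Qy [_ Py] _ _].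
  by apply: BQ; split=> // -[/zD].
by suff : set0 y1 by []; rewrite -PQ.
Qed.

End DiscreteExpansion.

(** * Adherence of one stationary embedding to another *)

Section StationaryEmbeddings.
Variables (K : Type) (lt : K -> K -> Prop) (G : topologicalType) (S : set K).
Hypothesis regK : uncountable_regular_cardinal lt.
Hypothesis hG : hausdorff_space G.
Hypothesis statS : stationary lt S.

Let wo : strict_well_order lt. Proof. by case: regK. Qed.

(* Two closed unbounded subsets of a stationary set meet, so two distinct points
   cannot both be limits of a sequence running to the end of S. *)
Lemma adherent_at_infinity_unique (f : K -> G) (X : set K) z1 z2 :
  hereditarily_normal G -> embeds_on lt S f -> X `<=` S ->
  (forall r, closure (f @` [set x | X x /\ lt r x]) z1) ->
  (forall r, closure (f @` [set x | X x /\ lt r x]) z2) -> z1 = z2.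
Proof.
move=> nG embf XS inf1 inf2; apply: contrapT => z12.
have [P1 [P2 [oP1 oP2 P1z P2z P12]]] := hausdorff_open hG z12.
(* Normality of [G] yields a neighbourhood [V] of [z2] with closure inside [P2]. A point [y] closed
   under [b1] and [b2] will have [f y] in the closures of both [P1] and [V]. *)
have [| | |U [V [[U' [oU UE]] [V' [oV VE]] CU DV UV]]] :=
  nG [set: G] (~` P2) [set z2].
- by exists (~` P2); rewrite setTI; split=> //; exact: open_closedC.
- by exists [set z2]; rewrite setTI; split=> //; exact: hausdorff_closed1.
- by apply/seteqP; split=> // x [/= xP2 xz]; apply: xP2; rewrite xz.
move: UE VE; rewrite !setTI => UE VE; subst U' V'.
have near_inf z (N : set G) : open N -> N z ->
    (forall r, closure (f @` [set x | X x /\ lt r x]) z) ->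
    forall r, exists x, [/\ X x, lt r x & N (f x)].
  move=> oN Nz infz r.
  by have [_ [x [Xx rx] <-] Nx] := closure_meets (infz r) oN Nz; exists x.
have /choice[b1 b1P] := near_inf z1 P1 oP1 P1z inf1.
have /choice[b2 b2P] := near_inf z2 V oV (DV _ erefl) inf2.
have /choice[b bP] : forall r, exists c, lt (b1 r) c /\ lt (b2 r) c.
  by move=> r; exact: lt_above2 regK _ _.
have [x0 _ [[z _] _]] := stationary_limit regK statS.
have [y [Sy zy yb]] := stationary_closure_point regK b z statS.
have in_nbhs (N : set G) (c : K -> K) : (forall r, [/\ X (c r), lt r (c r) & N (f (c r))]) ->
    (forall r, lt r y -> lt (c r) y) -> forall W, open W -> W (f y) -> exists2 x, N x & W x.
  move=> cP cy W oW Wy; have [s sy sW] := embeds_nbhs_below regK embf oW Sy Wy zy.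
  have [Xc sc Nc] := cP s; exists (f (c s)) => //; apply: sW => //; first exact: XS.
  by move=> /(ordlt_trans wo (cy _ sy)); exact: ordlt_irr.
have y1 := in_nbhs P1 b1 b1P (fun r ry => ordlt_trans wo (bP r).1 (yb r ry)).
have y2 := in_nbhs V b2 b2P (fun r ry => ordlt_trans wo (bP r).2 (yb r ry)).
have yP2 : ~ P2 (f y).
  move=> /(y1 P2 oP2)[x xP1 xP2]; suff : set0 x by [].
  by rewrite -P12.
have [x xV xU] := y2 U oU (CU _ yP2); suff : set0 x by [].
by rewrite -UV.
Qed.

(* The images q(y) of the isolated points of T have disjoint neighbourhoods, each
   meeting f([0, r]); fewer than K points are available there. *)
Lemma adherent_to_segment_bounded (f q : K -> G) (X T : set K) r :
  hereditarily_cwH G -> embeds_on lt S q -> T `<=` S ->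
  (forall y, T y -> closure (f @` [set x | X x /\ ~ lt r x]) (q y)) ->
  ~ unbounded lt T.
Proof.
move=> cwH embq TS clT ubT.
have JT : isolated_in lt T `<=` T by move=> y [].
have ubJ := unbounded_isolated regK ubT.
have [|U [UJ Udisj]] := @cwH_disjoint_expansion G (q @` isolated_in lt T) hG _ cwH.
  move=> _ [j Jj <-]; have [W [oW Wj WT]] := embeds_isolated regK embq TS Jj.
  by exists W; split=> // _ [j' /JT Tj' <-] /(WT _ Tj') ->.
have [u uP] := succ_ex regK r.
have /choice[phi phiP] : forall j, exists x, isolated_in lt T j ->
    lt x u /\ U (q j) (f x).
  move=> j; have [Jj|] := pselect (isolated_in lt T j); last by exists j.
  have [oU Uj] := UJ (q j) (ex_intro2 _ _ j Jj erefl).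
  have [_ [x [_ xr] <-] Ux] := closure_meets (clT _ (JT _ Jj)) oU Uj.
  by exists x => _; split=> //; apply/uP.
have [x xu ubx] := unbounded_fiber regK ubJ (fun j Jj => (phiP j Jj).1).
have [j [[Jj jx] _]] := ubx x; have [j' [[Jj' j'x] jj']] := ubx j.
have : q j = q j'.
  apply: (Udisj _ _ (f x)); [by exists j|by exists j'| |].
    by rewrite -jx; exact: (phiP j Jj).2.
  by rewrite -j'x; exact: (phiP j' Jj').2.
move=> /(embeds_inj embq (TS _ (JT _ Jj)) (TS _ (JT _ Jj'))) jE.
by apply: (ordlt_irr wo (x := j)); rewrite {2}jE.
Qed.

Lemma disjoint_embeddings_not_adherent (f q : K -> G) (X Y : set K) :
  hereditarily_normal G -> hereditarily_cwH G ->
  embeds_on lt S f -> embeds_on lt S q -> (forall y, S y -> f y <> q y) ->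
  X `<=` S -> unbounded lt Y ->
  exists y, [/\ S y, limit_of lt Y y & ~ closure (f @` X) (q y)].
Proof.
move=> nG cwH embf embq fq XS ubY; apply: contrapT => adhN.
(* If q y is in the closure of f(X) for all limits y of Y, let R(y) be the least R
   with q y in the closure of f([0, R]); it exists for all but one y. Since q is
   injective, R(y) < y cannot recur, and at a point y of S closed under R the
   points f(y) and q(y) have no disjoint neighbourhoods. *)
pose T := [set y | S y /\ limit_of lt Y y].
have adh y : T y -> closure (f @` X) (q y).
  by move=> [Sy Yy]; apply: contrapT => ?; apply: adhN; exists y.
pose below r := f @` [set x | X x /\ ~ lt r x].
have below_split r : f @` X `<=` below r `|` f @` [set x | X x /\ lt r x].
  move=> _ [x Xx <-]; have [rx|xr] := pselect (lt r x); first by right; exists x.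
  by left; exists x.
(* A [y] without [R] has [q y] adherent to every tail of [f] on [X]; uniqueness of such a point
   leaves at most one exception. *)
have [z0 z0P] : exists z, forall y, T y -> lt z y -> exists R, closure (below R) (q y).
  apply: contrapT => zN.
  have zP z : exists y, [/\ T y, lt z y & forall R, ~ closure (below R) (q y)].
    apply: contrapT => yN; apply: zN; exists z => y Ty zy.
    by apply: contrapT => RN; apply: yN; exists y; split=> // R clR; apply: RN; exists R.
  have inf y : T y -> (forall R, ~ closure (below R) (q y)) ->
      forall r, closure (f @` [set x | X x /\ lt r x]) (q y).
    move=> Ty yN r; have := adh y Ty => /(closureS (below_split r)).
    by rewrite closureU => -[/yN|].
  have [x0 _ _] := stationary_limit regK statS.
  have [y1 [T1 _ N1]] := zP x0; have [y2 [T2 y12 N2]] := zP y1.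
  have := adherent_at_infinity_unique nG embf XS (inf _ T1 N1) (inf _ T2 N2).
  move=> /(embeds_inj embq T1.1 T2.1) yE.
  by apply: (ordlt_irr wo (x := y1)); rewrite {2}yE.
(* The points of [T] whose images adhere to [below r] are bounded. *)
have /choice[b bP] : forall r, exists c, forall y, T y ->
    closure (below r) (q y) -> ~ lt c y.
  move=> r; apply: contrapT => cN.
  apply: (@adherent_to_segment_bounded f q X [set y | T y /\ closure (below r) (q y)] r)
    => //; [by move=> y [[]]|by move=> y []|].
  move=> c; apply: contrapT => yN; apply: cN; exists c => y Ty cly cy.
  by apply: yN; exists y.
(* A point closed under [c] is a limit of [Y] and, for each [r] below it, lies beyond [b r]. *)
have /choice[c cP] : forall r, exists c, [/\ lt (b r) c & exists2 t, Y t & lt r t /\ lt t c].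
  move=> r; have [t [Yt rt]] := ubY r.
  have [m [tm bm]] := lt_above2 regK t (b r).
  by exists m; split=> //; exists t.
have /choice[F FP] : forall r, exists R, exists y, [/\ S y, lt r y, lt y R,
    ~ closure (below r) (q y) & closure (below R) (q y)].
  move=> r; have [z [zr z0z]] := lt_above2 regK r z0.
  have [y [Sy zy yc]] := stationary_closure_point regK c z statS.
  have Ty : T y.
    split=> //; split; first by exists z.
    move=> s sy; have [_ [t Yt [st tc]]] := cP s; exists t; split=> //.
    exact: (ordlt_trans wo tc (yc _ sy)).
  have ry := ordlt_trans wo zr zy.
  have [R0 clR0] := z0P y Ty (ordlt_trans wo z0z zy).
  have [R [yR R0R]] := lt_above2 regK y R0.
  exists R, y; split=> //.
    have [brc _] := cP r.
    by move=> /(bP _ _ Ty); apply; exact: (ordlt_trans wo brc (yc _ ry)).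
  apply: closureS clR0 => _ [x [Xx R0x] <-]; exists x => //; split=> // Rx.
  by apply: R0x; exact: (ordlt_trans wo R0R Rx).
have [y [Sy zy yF]] := stationary_closure_point regK F z0 statS.
have [P1 [P2 [oP1 oP2 P1y P2y P12]]] := hausdorff_open hG (fq y Sy).
have [s1 s1y s1P] := embeds_nbhs_below regK embf oP1 Sy P1y zy.
have [s2 s2y s2P] := embeds_nbhs_below regK embq oP2 Sy P2y zy.
have [s [sy ss1 ss2]] := ordlt_max wo s1y s2y.
have [t [St st tF tN tcl]] := FP s; have Fy := yF s sy.
have P2t : P2 (q t).
  apply: s2P => //; first exact: (ordle_lt_trans wo ss2).
  by move=> /(ordlt_trans wo (ordlt_trans wo tF Fy)); exact: ordlt_irr.
(* [W] avoids [below s], so a point [f x] of [below (F s)] in [P2] and [W] has $s<x\le F(s)<y$ and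
   also lies in [P1]. *)
have [W [oW Wt WN]] := not_closure_open tN.
have [| |_ [x [Xx Fx] <-] [P2x Wx]] := closure_meets (W := P2 `&` W) tcl.
- exact: openI.
- by [].
suff : set0 (f x) by [].
rewrite -P12; split=> //; apply: s1P; first exact: XS.
  apply: (ordle_lt_trans wo ss1); apply: contrapT => sx.
  by apply: WN Wx; exists x.
by move=> /(ordlt_trans wo (ordle_lt_trans wo Fx Fy)); exact: ordlt_irr.
Qed.

End StationaryEmbeddings.

(** * Consequences of hereditary collectionwise normality *)

Section CollectionwiseNormal.
Variable G : topologicalType.
Hypothesis hG : hausdorff_space G.

Lemma hereditarily_cwN_normal : hereditarily_cwN G -> hereditarily_normal G.
Proof.
move=> cwN A C D [C' [cC' CE]] [D' [cD' DE]] CD.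
(* Members of a family are separated only when distinct; equal disjoint sets are empty. *)
have [CeD|CnD] := pselect (C = D).
  have C0 : C = set0 by rewrite -CD -CeD setIid.
  exists set0, set0; rewrite -CeD C0 setI0; split=> //.
    by exists set0; rewrite setI0; split=> //; exact: open0.
  by exists set0; rewrite setI0; split=> //; exact: open0.
have [| |U [UF Udisj]] := cwN A [set C; D].
- by move=> _ [->|->]; [exists C'|exists D'].
- move=> x Ax; have meetsN (E E' : set G) : E = A `&` E' -> A `&` ~` E' `&` E !=set0 -> False.
    by move=> -> [y [[_ yE] [_ /yE]]].
  have [xC|xC] := pselect (C' x).
    have xD : ~ D' x by move=> xD; suff : set0 x by []; rewrite -CD CE DE.
    exists (A `&` ~` D'); split=> //.
      by exists (~` D'); split=> //; exact: closed_openC.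
    by move=> F1 F2 [->|->] [->|->] // m1 m2; case: (meetsN D D').
  exists (A `&` ~` C'); split=> //.
    by exists (~` C'); split=> //; exact: closed_openC.
  by move=> F1 F2 [->|->] [->|->] // m1 m2; case: (meetsN C C').
have [UC CU] := UF C (or_introl erefl); have [UD DU] := UF D (or_intror erefl).
by exists (U C), (U D); split=> //; apply: Udisj => //; [left|right].
Qed.

(** The singletons of a closed discrete set form a discrete family of closed sets. *)
Lemma hereditarily_cwN_cwH : hereditarily_cwN G -> hereditarily_cwH G.
Proof.
move=> cwN A D [[D' [cD' DE]] discD].
have DA d : D d -> A d by rewrite DE => -[].
have [| |U [UF Udisj]] := cwN A [set [set d] | d in D].
- move=> _ [d Dd <-]; exists [set d]; split; first exact: hausdorff_closed1.
  by apply/esym/setIidr => _ ->; exact: DA.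
- move=> x Ax; have [Dx|xD] := pselect (D x).
    have [U [oU UD]] := discD x Dx; exists U; split=> //.
      by have [] : (U `&` D) x by rewrite UD.
    have Ux d : D d -> U `&` [set d] !=set0 -> d = x.
      move=> Dd [y [Uy yd]]; suff : (U `&` D) d by rewrite UD.
      by split=> //; rewrite -yd.
    by move=> _ _ [d Dd <-] [d' Dd' <-] /(Ux d Dd) -> /(Ux d' Dd') ->.
  exists (A `&` ~` D'); split=> //.
  + by exists (~` D'); split=> //; exact: closed_openC.
  + by split=> // D'x; apply: xD; rewrite DE.
  + move=> _ F2 [d Dd <-] _ [y [[_ yD'] yd]] _; case: yD'; rewrite yd.
    by move: Dd; rewrite DE => -[].
exists (fun d => U [set d]); split=> [d Dd|d d' Dd Dd' dd'].
  have [oU dU] : rel_open A (U [set d]) /\ [set d] `<=` U [set d] by apply: UF; exists d.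
  by split=> //; exact: dU.
apply: Udisj; [by exists d|by exists d'|].
by move=> /seteqP[/(_ d erefl)].
Qed.

End CollectionwiseNormal.

(** Open sets are carried over by preimage under [h']. It serves for left translations, whose
    inverses are again continuous translations. *)
Lemma embeds_on_comp (K : Type) (lt : K -> K -> Prop) (G : topologicalType)
    (S : set K) (f : K -> G) (h h' : G -> G) :
  continuous h -> continuous h' -> cancel h h' ->
  embeds_on lt S f -> embeds_on lt S (h \o f).
Proof.
move=> ch ch' hK [injf embf]; split.
  by move=> x y Sx Sy /(can_inj hK) /injf; apply.
move=> U; rewrite embf; split=> -[W [oW ->]].
  exists (h' @^-1` W); split; first by move/continuousP: ch'; apply.
  by apply/seteqP; split=> x [Sx] /=; rewrite hK.
by exists (h @^-1` W); split=> //; move/continuousP: ch; apply.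
Qed.

(** * Translating a stationary embedding in the group *)

Section StationaryInGroup.
Variables (G : topologicalType) (mul : G -> G -> G) (e : G) (inv : G -> G).
Hypothesis grpG : paratopological_group mul e inv.

Let mulA x y z : mul x (mul y z) = mul (mul x y) z. Proof. by case: grpG. Qed.
Let mul1 x : mul e x = x. Proof. by case: grpG => _ []. Qed.
Let mulV x : mul (inv x) x = e. Proof. by case: grpG => _ [_ [_ []]]. Qed.
Let mulVr x : mul x (inv x) = e. Proof. by case: grpG => _ [_ [_ [_ []]]]. Qed.

Lemma mul_continuousr x : continuous (mul x).
Proof.
case: grpG => _ [_ [_ [_ [_ cmul]]]] y.
apply: (@continuous_comp _ _ _ (fun y => (x, y)) (fun p => mul p.1 p.2)); last exact: cmul.
by apply: cvg_pair; [exact: cvg_cst|exact: cvg_id].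
Qed.

Lemma mul_continuousl y : continuous (mul^~ y).
Proof.
case: grpG => _ [_ [_ [_ [_ cmul]]]] x.
apply: (@continuous_comp _ _ _ (fun x => (x, y)) (fun p => mul p.1 p.2)); last exact: cmul.
by apply: cvg_pair; [exact: cvg_id|exact: cvg_cst].
Qed.

Lemma no_stationary_embedding (K : Type) (lt : K -> K -> Prop) (S : set K) (f : K -> G) :
  hausdorff_space G -> hereditarily_normal G -> hereditarily_cwH G ->
  uncountable_regular_cardinal lt -> stationary lt S -> ~ embeds_on lt S f.
Proof.
move=> hG nG cwH regK statS embf.
have wo : strict_well_order lt by case: regK.
have [p Sp [[z zp] limp]] := stationary_limit regK statS.
pose J := isolated_in lt S; have JS : J `<=` S by move=> y [].
have ubJ : unbounded lt J := unbounded_isolated regK (stationary_unbounded regK statS).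
have [|O [OJ Odisc]] := @discrete_open_expansion G (f @` J) hG _ cwH nG.
  move=> _ [j Jj <-].
  have [W [oW Wj WS]] := embeds_isolated regK embf (fun _ => id) Jj.
  by exists W; split=> // _ [j' /JS Sj' <-] /(WS _ Sj') ->.
have OJ' j (Jj : J j) := OJ (f j) (ex_intro2 _ _ j Jj erefl).
pose h x := mul (f x) (inv (f p)).
(* Right multiplication by [c] is continuous and sends [f p] to [f j], so points close below [p] are
   sent into [O (f j)]. *)
have /choice[phi phiP] : forall j, exists s, J j ->
    lt s p /\ forall x, S x -> lt s x -> lt x p -> O (f j) (mul (h x) (f j)).
  move=> j; have [Jj|] := pselect (J j); last by exists j.
  have [oO Oj] := OJ' j Jj; pose c := mul (inv (f p)) (f j).
  have oW : open (mul^~ c @^-1` O (f j)).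
    by have /continuousP := @mul_continuousl c; apply.
  have Wp : (mul^~ c @^-1` O (f j)) (f p) by rewrite /preimage /= mulA mulVr mul1.
  have [s sp sP] := embeds_nbhs_below regK embf oW Sp Wp zp.
  exists s => _; split=> // x Sx sx xp; rewrite /h -mulA; apply: sP => //.
  by move=> /(ordlt_trans wo xp); exact: ordlt_irr.
have [r rp ubI] := unbounded_fiber regK ubJ (fun j Jj => (phiP j Jj).1).
have [x [Sx rx xp]] := limp r rp.
have embq : embeds_on lt S (mul (h x) \o f).
  apply: (embeds_on_comp (h' := mul (inv (h x)))) embf; try exact: mul_continuousr.
  by move=> y; rewrite mulA mulV mul1.
(* Equality would make [h x] the identity, that is $f(x)=f(p)$, against $x<p$. *)
have fq y : S y -> f y <> (mul (h x) \o f) y.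
  move=> Sy /= /(congr1 (mul^~ (inv (f y)))); rewrite -mulA mulVr /h.
  case: grpG => _ [_ [mulr1 _]]; rewrite mulr1 => /(congr1 (mul^~ (f p))).
  rewrite mul1 -mulA mulV mulr1 => /(embeds_inj embf Sp Sx) px.
  by apply: (ordlt_irr wo (x := p)); rewrite {1}px.
have [y [Sy [[t ty] limy] adhN]] :=
  disjoint_embeddings_not_adherent regK hG statS nG cwH embf embq fq JS ubI.
have [|N [oN Ny ND]] := Odisc ((mul (h x) \o f) y) _; first by move=> /adhN.
have [s sy sN] := embeds_nbhs_below regK embq oN Sy Ny ty.
(* Two members $i<j$ of the fiber close to [y] have images in [N] that lie in [O (f i)] and
   [O (f j)]; discreteness at the image of [y] then forces $f(i)=f(j)$. *)
have [i [[Ji ir] si iy]] := limy s sy.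
have [j [[Jj jr] ij jy]] := limy i iy.
have inO k (Jk : J k) (kr : phi k = r) : O (f k) ((mul (h x) \o f) k).
  by have [_] := phiP k Jk; apply=> //; rewrite kr.
have inN k (Jk : J k) (sk : lt s k) (ky : lt k y) : N ((mul (h x) \o f) k).
  apply: sN => //; first exact: JS.
  by move=> /(ordlt_trans wo ky); exact: ordlt_irr.
have : f i = f j.
  apply: ND; [by exists i|by exists j|exact: (inN i)|exact: inO|
    exact: (inN j Jj (ordlt_trans wo si ij) jy)|exact: inO].
move=> /(embeds_inj embf (JS _ Ji) (JS _ Jj)) ijE.
by apply: (ordlt_irr wo (x := i)); rewrite {2}ijE.
Qed.

End StationaryInGroup.

Unset Implicit Arguments.

Theorem theorem2p4 (G : topologicalType) (mul : G -> G -> G) (e : G) (inv : G -> G) :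
  tychonoff_space G ->
  paratopological_group mul e inv ->
  (exists (K : Type) (lt : K -> K -> Prop) (S : set K) (f : K -> G),
      [/\ uncountable_regular_cardinal lt, stationary lt S & embeds_on lt S f]) ->
  (~ hereditarily_normal G \/ ~ hereditarily_cwH G) /\ ~ hereditarily_cwN G.
Proof.
move=> [_ hG] grpG [K [lt [S [f [regK statS embf]]]]].
have notboth : hereditarily_normal G -> hereditarily_cwH G -> False.
  by move=> nG cwH; exact: (no_stationary_embedding grpG hG nG cwH regK statS embf).
split.
  have [nG|] := pselect (hereditarily_normal G); last by left.
  by right => /(notboth nG).
move=> cwN; apply: notboth; first exact: hereditarily_cwN_normal.
exact: hereditarily_cwN_cwH.
Qed.
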